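(* Let $\Gamma$ be a finitely generated group of exponential growth and let $S(\cdot)$ be the random walk on $\Gamma$ whose increments have a symmetric law $\mu$ supported exactly on a finite symmetric generating set $\mathcal{S}$ of $\Gamma$. Let $d$ be the associated hitting distance, $K=\max\{d(e,x):x\in\mathcal{S}\}$, and let $V(n)=\#\{y\in\Gamma: d(e,y)\le Kn\}$. Then there exist two constants $C_a>0$ and $C_b>0$ such that for every integer $n\ge 1$, $$C_a\exp(Kn)\le V(n)\le C_b\, n^3\exp(Kn).$$
   Context: $\Gamma$ is a finitely generated group with identity $e$, $\mathcal{S}$ is a finite symmetric generating set, $|x|$ is the word length of $x$ with respect to $\mathcal{S}$, and $V_w(n)=\#\{x\in\Gamma:|x|\le n\}$. Exponential growth means that there is a constant $c>0$ with $V_w(n)\ge \exp(cn)$ for all $n$. The law $\mu$ is a probability measure on $\Gamma$ with support $\mathcal{S}$ and $\mu(s)=\mu(s^{-1})$. With $(X_k)_{k\ge1}$ i.i.d. of law $\mu$, the random walk started at $x$ is $S(0)=x$, $S(k)=xX_1X_2\cdots X_k$; its law is denoted $\mathbb{P}^x$. The hitting time of $y$ is $\tau_y=\inf\{k\ge 0: S(k)=y\}$ (with $\inf\emptyset=\infty$), $F(x,y)=\mathbb{P}^x[\tau_y<\infty]$, and the hitting distance is $d(x,y)=-\ln F(x,y)$, a left invariant distance on $\Gamma$. *)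

(* Defs.v *)
From HB Require Import structures.
From mathcomp Require Import all_boot all_order all_algebra finmap.
From mathcomp Require Import all_classical all_reals all_analysis.

Set Implicit Arguments.
Unset Strict Implicit.
Unset Printing Implicit Defensive.

Import Order.TTheory GRing.Theory Num.Theory.

Local Open Scope classical_set_scope.
Local Open Scope ring_scope.

(* [groupType] is the library's structure of arbitrary, possibly infinite,
   groups; finite generation is expressed by a generating set S : {fset G}. *)

Definition word_prod (G : groupType) (w : seq G) : G := \big[*%g/1%g]_(s <- w) s.

Definition is_word_of (G : groupType) (S : {fset G}) (x : G) (w : seq G) : Prop :=
  {subset w <= S} /\ word_prod w = x.

Definition symmetric_set (G : groupType) (S : {fset G}) : Prop :=
  forall x : G, x \in S -> (x^-1)%g \in S.

(* Every element is a product of elements of S; no inverses are needed since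
   this is only used for symmetric S. *)
Definition generating (G : groupType) (S : {fset G}) : Prop :=
  forall x : G, exists w : seq G, is_word_of S x w.

(* Least length of a word in S representing x; the default value 0 is only
   taken for elements that are not products of elements of S. *)
Definition word_length (G : groupType) (S : {fset G}) (x : G) : nat :=
  xget 0%N [set n | (exists2 w, is_word_of S x w & size w = n) /\
                    (forall w, is_word_of S x w -> (n <= size w)%N)].

(* Cardinalities are values of [counting], which is +oo on infinite sets. *)
Definition word_growth (R : realType) (G : groupType) (S : {fset G}) (n : nat)
    : \bar R :=
  @counting G R [set x : G | (word_length S x <= n)%N].

Definition exponential_growth (R : realType) (G : groupType) (S : {fset G})
    : Prop :=
  exists2 c : R, 0 < c &
    forall n : nat, ((expR (c * n%:R))%:E <= word_growth R S n)%E.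

(* A probability measure on the (countable) group G, given by its masses. *)
Definition probability_law (R : realType) (G : groupType) (mu : G -> R) : Prop :=
  (forall x, 0 <= mu x) /\ (\esum_(x in [set: G]) (mu x)%:E = 1)%E.

(* G carries the discrete sigma-algebra: all its subsets are measurable. *)
Definition discrete_rv d (T : measurableType d) (G : Type) (Y : T -> G) : Prop :=
  forall A : set G, measurable (Y @^-1` A).

Definition mutually_independent d (T : measurableType d) (R : realType)
    (P : probability T R) (G : Type) (X : nat -> T -> G) : Prop :=
  forall (J : {fset nat}) (A : nat -> set G),
    (P (\bigcap_(i in [set` J]) (X i @^-1` A i))
     = \prod_(i <- J) P (X i @^-1` A i))%E.

Definition iid_of_law d (T : measurableType d) (R : realType)
    (P : probability T R) (G : groupType) (mu : G -> R) (X : nat -> T -> G)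
    : Prop :=
  [/\ forall k, discrete_rv (X k),
      forall k x, P (X k @^-1` [set x]) = (mu x)%:E
    & mutually_independent P X].

(* The increments are numbered from 0: X k is the (k+1)-st increment, so that
   walk X x k t = x * X 0 t * ... * X (k-1) t. *)
Definition walk (T : Type) (G : groupType) (X : nat -> T -> G) (x : G) (k : nat)
    (t : T) : G :=
  (x * \big[*%g/1%g]_(i < k) X i t)%g.

(* Hitting time of y for the walk started at x; it is +oo if y is never hit,
   as the infimum of the empty set. *)
Definition hitting_time (R : realType) (T : Type) (G : groupType)
    (X : nat -> T -> G) (x y : G) (t : T) : \bar R :=
  ereal_inf [set (k%:R : R)%:E | k in [set k : nat | walk X x k t = y]].

Definition hitting_prob d (T : measurableType d) (R : realType)
    (P : probability T R) (G : groupType) (X : nat -> T -> G) (x y : G) : R :=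
  fine (P [set t | (hitting_time R X x y t < +oo)%E]).

(* For a symmetric finite generating support the hitting probabilities are
   positive, so the totalized value ln 0 = 0 is never used. *)
Definition hitting_dist d (T : measurableType d) (R : realType)
    (P : probability T R) (G : groupType) (X : nat -> T -> G) (x y : G) : R :=
  - ln (hitting_prob P X x y).

(* Maximum of d(e, x) over x in S; as d >= 0, the initial value 0 does not
   affect it when S is non-empty. *)
Definition hitting_step d (T : measurableType d) (R : realType)
    (P : probability T R) (G : groupType) (X : nat -> T -> G) (S : {fset G})
    : R :=
  \big[Num.max/0]_(x <- S) hitting_dist P X 1%g x.

Definition hitting_growth d (T : measurableType d) (R : realType)
    (P : probability T R) (G : groupType) (X : nat -> T -> G) (S : {fset G})
    (n : nat) : \bar R :=
  @counting G R
    [set y : G | hitting_dist P X 1%g y <= hitting_step P X S * n%:R].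

(* Main.v *)
(* Let p_k be the law of the walk at time k, phi(k) = p_(2k)(1) and
   gap(k) = phi(k) - phi(k+1).

   Heat kernel decay.  p_(2k) is positive definite, so the square root of
   phi(k) - p_(2k)(x) is subadditive in x; it is O(sqrt(gap(k))) when x is a
   product of two generators, hence O(r sqrt(gap(k))) on even words of length
   at most r.  Summing p_(2k) over the ball of radius r, which has at least
   exp(c r) points, gives phi(k) <= 2 exp(- c r) + O(r^2) gap(k), and r of
   order 1 - ln phi(k) turns this into phi(k) <= O(u^2) gap(k) with
   u = b - ln phi(k).  It follows that u^3 grows at least linearly in k, and
   that phi(k) <= M (sqrt(phi(k)) - sqrt(phi(k+1))); by telescoping, the sum of
   phi(k) over k >= A n^3 is at most exp(- K n) / 4 for a suitable A.

   Upper bound.  F(1, y) is at most the sum of p_k(y) over all k.  If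
   F(1, y) >= exp(- K n), then at least half of exp(- K n) comes from the times
   k < 2 A n^3, and these contribute at most 2 A n^3 in total over all y.

   Lower bound.  The walk eventually leaves the finite set
   B = {y | d(1, y) <= K n}, through a set of at most #|B| #|S| points, each
   hit with probability less than exp(- K n). *)

Require Import Defs.
From HB Require Import structures.
From mathcomp Require Import all_boot all_order all_algebra finmap.
From mathcomp Require Import all_classical all_reals all_analysis.
From mathcomp Require Import ring lra.

Set Implicit Arguments.
Unset Strict Implicit.
Unset Printing Implicit Defensive.

Import Order.TTheory GRing.Theory Num.Theory.

Local Open Scope classical_set_scope.
Local Open Scope ring_scope.

Lemma sumr_const_seq (R : pzRingType) (I : Type) (r : seq I) (a : R) :
  \sum_(i <- r) a = (size r)%:R * a.
Proof. by rewrite big_const_seq count_predT iter_addr_0 mulr_natl. Qed.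

(** * Convolution powers of [mu] and their positive definiteness *)

Section Steps.
Context {R : realFieldType} {G : groupType}.
Variables (S : {fset G}) (mu : G -> R).
Hypothesis S_sym : forall x : G, x \in S -> (x^-1)%g \in S.
Hypothesis mu_pos : forall s, s \in S -> 0 < mu s.
Hypothesis mu_sym : forall x : G, mu (x^-1)%g = mu x.
Hypothesis mu_sum : \sum_(s <- S) mu s = 1.

(** The mass at [x] of the k-fold convolution power of [mu], defined without a probability space;
    [walk_law] identifies it with the law of the walk at time [k]. *)
Fixpoint step_prob (k : nat) (x : G) : R :=
  if k is k'.+1 then \sum_(s <- S) mu s * step_prob k' (x * s^-1)%g
  else (x == 1%g)%:R.
Local Notation p := step_prob.

Lemma sum_symmetric_inv (f : G -> R) :
  \sum_(s <- S) f (s^-1)%g = \sum_(s <- S) f s.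
Proof.
rewrite -(big_map (fun s => s^-1)%g predT f); apply: perm_big.
apply: uniq_perm; rewrite ?map_inj_uniq ?fset_uniq//; first exact: invg_inj.
move=> x; apply/mapP/idP => [[y yS ->]|xS]; first exact: S_sym.
by exists (x^-1)%g; rewrite ?invgK//; apply: S_sym.
Qed.

Lemma step_prob_ge0 k x : 0 <= p k x.
Proof.
elim: k x => [|k IHk] x /=; first exact: ler0n.
by rewrite big_seq sumr_ge0// => s sS; rewrite mulr_ge0 ?IHk// ltW ?mu_pos.
Qed.

(** Powers of [mu] commute with [mu]: by induction, peeling off the last and then the first
    increment gives a double sum, which may be reordered. *)
Lemma step_probSl k x : p k.+1 x = \sum_(s <- S) mu s * p k (s^-1 * x)%g.
Proof.
elim: k x => [|k IHk] x.
  by apply: eq_bigr => s _ /=; rewrite divg_eq1 mulg_eq1 eqg_inv eq_sym.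
rewrite [LHS]/=; under eq_bigr => s _ do rewrite -/(p k.+1 _) IHk mulr_sumr.
rewrite exchange_big; apply: eq_bigr => t _ /=; rewrite mulr_sumr.
by apply: eq_bigr => s _; rewrite mulrCA mulgA.
Qed.

Lemma step_probV k x : p k (x^-1)%g = p k x.
Proof.
elim: k x => [|k IHk] x; first by rewrite /= invg_eq1.
rewrite step_probSl /= -[RHS]sum_symmetric_inv; apply: eq_bigr => s _.
by rewrite mu_sym invgK -[in RHS]IHk invgM.
Qed.

(** With the last increment written as the inverse of [t], the argument takes the form that the
    change of test family in [step_prob_posdef] requires. *)
Lemma step_prob_add2 k x : p k.+2 x =
  \sum_(s <- S) \sum_(t <- S) mu s * mu t * p k (s^-1 * x * t)%g.
Proof.
rewrite step_probSl; apply: eq_bigr => s _; rewrite /= -sum_symmetric_inv.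
rewrite mulr_sumr.
by apply: eq_bigr => t _; rewrite mu_sym invgK mulrA.
Qed.

(* Splitting off the first and the last step replaces the test family
   (c_i, x_i) by (c_i mu(s), x_i s), which reduces k + 1 to k. *)
Lemma step_prob_posdef k (l : seq (R * G)) :
  0 <= \sum_(a <- l) \sum_(b <- l) a.1 * b.1 * p k.*2 (a.2^-1 * b.2)%g.
Proof.
elim: k l => [|k IHk] l.
  (* For [k = 0] the kernel is the indicator of [a.2 = b.2], so the form is a sum of squares over
     the distinct group elements occurring in [l]. *)
  set r := undup [seq a.2 | a <- l].
  rewrite [leRHS](_ : _ =
      \sum_(g <- r) (\sum_(a <- l) a.1 * (a.2 == g)%:R) ^+ 2).
    by apply: sumr_ge0 => g _; exact: sqr_ge0.
  under [RHS]eq_bigr do rewrite expr2 mulr_suml.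
  rewrite [RHS]exchange_big big_seq [RHS]big_seq; apply: eq_bigr => a al.
  under [RHS]eq_bigr do rewrite mulr_sumr.
  rewrite [RHS]exchange_big; apply: eq_bigr => b _ /=.
  have ar : a.2 \in r by rewrite mem_undup map_f.
  rewrite (bigD1_seq a.2) ?undup_uniq//= eqxx big1 ?addr0; last first.
    by move=> g /negPf; rewrite eq_sym => ->; rewrite mulr0 mul0r.
  by rewrite mulg_eq1 eqg_inv [b.2 == _]eq_sym mulr1n; ring.
pose l' := [seq (a.1 * mu s, (a.2 * s)%g) | a <- l, s <- (S : seq G)].
have := IHk l'; rewrite doubleS /l' big_allpairs_dep; congr (_ <= _).
apply: eq_bigr => a _ /=.
under eq_bigr => s _ do rewrite big_allpairs_dep /=.
rewrite exchange_big; apply: eq_bigr => b _ /=.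
rewrite -/(p k.*2.+2 _) step_prob_add2 mulr_sumr; apply: eq_bigr => s _.
rewrite mulr_sumr; apply: eq_bigr => t _.
by rewrite invgM !mulgA; ring.
Qed.

Local Notation h k x := (p k.*2 1%g - p k.*2 x).

(** Positive definiteness tested on delta_1 - delta_x, together with the symmetry of [p]. *)
Lemma step_prob_max k x : p k.*2 x <= p k.*2 1%g.
Proof.
have := step_prob_posdef k [:: (1, 1%g); (-1, x)].
rewrite !big_cons !big_nil /= !invg1 !mul1g !mulg1 !mulVg step_probV; lra.
Qed.

(* Positive definiteness tested on t delta_1 - (t + 1) delta_x + delta_(xy). *)
Lemma step_drop_mul k x y (t : R) : 0 < t ->
  h k (x * y)%g <= (t + 1) * h k x + (1 + t^-1) * h k y.
Proof.
move=> t_gt0.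
have := step_prob_posdef k [:: (t, 1%g); (- (t + 1), x); (1, (x * y)%g)].
rewrite !big_cons !big_nil /= !invg1 !mul1g !mulg1 !mulVg !mulKg.
rewrite !invgM mulgVK -!invgM !step_probV => H.
(* Multiplied by [2 * t], the difference of the two sides is exactly the quadratic form in [H]. *)
rewrite -subr_ge0 -(pmulr_rge0 _ (mulr_gt0 (ltr0n R 2) t_gt0)).
by move: H; congr (_ <= _); field; rewrite gt_eqF.
Qed.


Lemma support_nonempty : exists s, s \in S.
Proof.
have [E|/fset0Pn//] := eqVneq S fset0.
by move: mu_sum; rewrite E big_seq_fset0 => /eqP; rewrite eq_sym oner_eq0.
Qed.

Lemma step_prob_sum_le1 k (Y : seq G) : uniq Y -> \sum_(y <- Y) p k y <= 1.
Proof.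
elim: k Y => [|k IHk] Y uY /=.
  rewrite -natr_sum -[leRHS](mulr1n 1) ler_nat.
  have -> : (\sum_(y <- Y) (y == 1%g) = count_mem 1%g Y)%N.
    by rewrite -sum1_count [RHS]big_mkcond; apply: eq_bigr => y _ /=; case: eqP.
  by rewrite count_uniq_mem// leq_b1.
rewrite exchange_big -[leRHS]mu_sum big_seq [leRHS]big_seq.
apply: ler_sum => s sS; rewrite -mulr_sumr ler_piMr ?(ltW (mu_pos sS))//.
rewrite -(big_map (fun y => (y * s^-1)%g) predT (p k)) IHk// map_inj_uniq//.
exact: mulIg.
Qed.

(** An odd-time value is a [mu]-average of even-time values, to which [step_prob_max] applies. *)
Lemma step_prob_odd k x : p k.*2.+1 x <= p k.*2 1%g.
Proof.
rewrite /= -[leRHS]mul1r -mu_sum mulr_suml big_seq [leRHS]big_seq.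
by apply: ler_sum => s sS; rewrite ler_pM2l ?mu_pos// step_prob_max.
Qed.

(** * The two-step decrease of the return probability and the ball estimate *)

Local Notation gap k := (p k.*2 1%g - p k.+1.*2 1%g).

Lemma gap_sum k : gap k =
  \sum_(s <- S) \sum_(t <- S) mu s * mu t * h k (s^-1 * t)%g.
Proof.
rewrite doubleS step_prob_add2 -[p k.*2 1%g in LHS]mul1r -{1}mu_sum mulr_suml.
rewrite -sumrB; apply: eq_bigr => s _; set q := p _ 1%g.
rewrite -[mu s in LHS]mulr1 -{1}mu_sum mulr_sumr mulr_suml -sumrB.
by apply: eq_bigr => t _; rewrite mulg1 mulr1 mulrBr.
Qed.

(** One term of the average [gap_sum], at the pair [s^-1], [t]; the others are nonnegative by
    [step_prob_max]. *)
Lemma gap_ge_pair k s t : s \in S -> t \in S ->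
  mu s * mu t * h k (s * t)%g <= gap k.
Proof.
move=> sS tS; rewrite gap_sum (bigD1_seq (s^-1)%g) ?fset_uniq ?S_sym//=.
rewrite (bigD1_seq t) ?fset_uniq//= invgK mu_sym -[leLHS]addr0 -addrA lerD2l.
have h_ge0 u v : u \in S -> v \in S -> 0 <= mu u * mu v * h k (u^-1 * v)%g.
  by move=> uS vS; rewrite !mulr_ge0 ?(ltW (mu_pos _)) ?subr_ge0 ?step_prob_max.
rewrite addr_ge0//; rewrite big_seq_cond; apply: sumr_ge0 => u /andP[uS _].
  by have := h_ge0 _ _ (S_sym sS) uS; rewrite invgK mu_sym.
by rewrite big_seq sumr_ge0// => v vS; exact: h_ge0.
Qed.

Lemma gap_ge0 k : 0 <= gap k.
Proof.
rewrite gap_sum big_seq sumr_ge0// => s sS; rewrite big_seq sumr_ge0// => t tS.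
by rewrite !mulr_ge0 ?(ltW (mu_pos _)) ?subr_ge0 ?step_prob_max.
Qed.

Section MinMass.
Variable (m : R).
Hypotheses (m_gt0 : 0 < m) (m_min : forall s, s \in S -> m <= mu s).

Lemma step_drop_word k n (w : seq G) : {subset w <= S} -> size w = n.*2 ->
  h k (word_prod w) <= n%:R ^+ 2 * (gap k / m ^+ 2).
Proof.
elim: n w => [|n IHn] [|s [|t w]]//= wS.
  by rewrite /word_prod big_nil subrr expr0n mul0r.
rewrite doubleS => -[sw].
have {}IHn : h k (word_prod w) <= n%:R ^+ 2 * (gap k / m ^+ 2).
  by apply: IHn => // x xw; apply: wS; rewrite !inE xw !orbT.
have sS : s \in S by apply: wS; rewrite inE eqxx.
have tS : t \in S by apply: wS; rewrite !inE eqxx orbT.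
have hst : h k (s * t)%g <= gap k / m ^+ 2.
  rewrite ler_pdivlMr ?exprn_gt0//; apply: le_trans (gap_ge_pair k sS tS).
  rewrite mulrC ler_wpM2r ?subr_ge0 ?step_prob_max// expr2.
  by rewrite ler_pM ?m_min// ltW.
rewrite /word_prod !big_cons mulgA -/(word_prod w).
(* The weight in [step_drop_mul] will be half the length of the remaining word, so the empty word is
   treated apart. *)
case: n sw IHn => [|n] sw IHn.
  by move/size0nil: sw => ->; rewrite /word_prod big_nil mulg1 expr1n mul1r.
(* With weight [t = n + 1] the recursion closes on squares: [(n + 2) + (1 + 1 / (n + 1)) * (n + 1) ^
   2 = (n + 2) ^ 2]. *)
have := @step_drop_mul k (s * t)%g (word_prod w) n.+1%:R (ltr0Sn _ _).
move/le_trans; apply; set D := gap k / _ in hst IHn *.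
have -> : n.+2%:R ^+ 2 * D = (n.+1%:R + 1) * D +
    (1 + n.+1%:R^-1) * (n.+1%:R ^+ 2 * D) :> R.
  rewrite -[n.+2]addn1 natrD; field; exact: lt0r_neq0.
by rewrite lerD// ler_wpM2l// addr_ge0// invr_ge0.
Qed.

(** The bound [r + 1] leaves room for one generator appended to a word of length [r]. *)
Lemma step_drop_even k r (w : seq G) :
  {subset w <= S} -> ~~ odd (size w) -> (size w <= r.+1)%N ->
  p k.*2 1%g - r.+1%:R ^+ 2 * (gap k / m ^+ 2) <= p k.*2 (word_prod w).
Proof.
move=> wS w_even wr; rewrite lerBlDl -lerBlDr.
have sw : size w = (size w)./2.*2.
  by rewrite -[LHS]odd_double_half (negbTE w_even).
apply: le_trans (step_drop_word k wS sw) _.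
rewrite ler_wpM2r ?divr_ge0 ?gap_ge0 ?exprn_ge0 ?(ltW m_gt0)//.
rewrite ler_pXn2r ?nnegrE ?ler0n// ler_nat (leq_trans _ wr)//.
by rewrite [leqRHS]sw -addnn leq_addr.
Qed.

(* A word of odd length is made even by appending a fixed generator, so that
   parity costs a factor 2 only. *)
Lemma ball_bound k r (Y : seq G) : uniq Y ->
    (forall y, y \in Y -> exists2 w, is_word_of S y w & (size w <= r)%N) ->
  (size Y)%:R * (p k.*2 1%g - r.+1%:R ^+ 2 * (gap k / m ^+ 2)) <= 2.
Proof.
move=> uY Yr; set c := (X in _ * X).
have [s0 s0S] := support_nonempty.
have c_le y : y \in Y -> c <= p k.*2 y + p k.*2 (y * s0)%g.
  move=> /Yr[w [wS <-] wr]; have [w_odd|w_even] := boolP (odd (size w)).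
    rewrite -[leLHS]add0r lerD ?step_prob_ge0//.
    have -> : (word_prod w * s0)%g = word_prod (rcons w s0).
      by rewrite /word_prod -cats1 big_cat big_seq1.
    apply: step_drop_even; rewrite ?size_rcons /= ?negbK//.
    by move=> x; rewrite mem_rcons inE => /predU1P[->//|]; exact: wS.
  rewrite -[leLHS]addr0 lerD ?step_prob_ge0//.
  by apply: step_drop_even => //; exact: leqW.
rewrite -sumr_const_seq.
apply: (@le_trans _ _ (\sum_(y <- Y) (p k.*2 y + p k.*2 (y * s0)%g))).
  by rewrite big_seq [leRHS]big_seq; apply: ler_sum => y; exact: c_le.
rewrite big_split (_ : 2 = 1 + 1)// lerD ?step_prob_sum_le1//.
rewrite -(big_map (fun y => (y * s0)%g) predT (p k.*2)) step_prob_sum_le1//.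
by rewrite map_inj_uniq//; exact: mulIg.
Qed.

End MinMass.

Lemma step_prob_mul_ge k s x : s \in S -> mu s * p k x <= p k.+1 (s * x)%g.
Proof.
move=> sS; rewrite step_probSl (bigD1_seq s) ?fset_uniq//= mulKg lerDl.
rewrite big_seq_cond sumr_ge0// => t /andP[tS _].
by rewrite mulr_ge0 ?step_prob_ge0 ?ltW ?mu_pos.
Qed.

Lemma step_prob_word_gt0 (w : seq G) : {subset w <= S} ->
  0 < p (size w) (word_prod w).
Proof.
elim: w => [|s w IHw] wS; first by rewrite /word_prod big_nil /= eqxx.
have sS : s \in S by apply: wS; rewrite inE eqxx.
rewrite /word_prod big_cons; apply: lt_le_trans (step_prob_mul_ge _ _ sS).
by rewrite mulr_gt0 ?mu_pos// IHw// => t tw; apply: wS; rewrite inE tw orbT.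
Qed.

Lemma step_prob_return_gt0 k : 0 < p k.*2 1%g.
Proof.
have [s sS] := support_nonempty.
elim: k => [|k IHk]; first by rewrite /= eqxx.
rewrite doubleS -[1%g](mulgV s) -[(s^-1)%g]mulg1.
apply: lt_le_trans (step_prob_mul_ge _ _ sS); rewrite mulr_gt0 ?mu_pos//.
apply: lt_le_trans (step_prob_mul_ge _ _ (S_sym sS)).
by rewrite mulr_gt0 ?mu_pos ?S_sym.
Qed.

End Steps.

(** * Decay of a sequence satisfying a Nash-type inequality *)

Section Decay.
Context {R : realType}.
Variables (phi : nat -> R) (c C : R).
Hypotheses (c_gt0 : 0 < c) (C_gt0 : 0 < C).
Hypothesis phi_gt0 : forall k, 0 < phi k.
Hypothesis phi_le1 : forall k, phi k <= 1.
Hypothesis phi_dec : forall k, phi k.+1 <= phi k.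
Hypothesis phi_nash : forall k r : nat,
  expR (c * r%:R) * (phi k - r.+1%:R ^+ 2 * (C * (phi k - phi k.+1))) <= 2.

(* [phi_nash] is applied with a radius r such that r + 1 <= u k / c. *)
Local Notation b := (ln 4 + 2 * c).
Local Notation u k := (b - ln (phi k)).
Local Notation kappa := (2 * C / c ^+ 2).
Local Notation M := (16 * kappa * expR (b / 2)).

Lemma decay_b_gt0 : 0 < b.
Proof. by rewrite ltr_pwDr ?mulr_gt0// ln_ge0// ler1n. Qed.

Lemma decay_u_ge k : b <= u k.
Proof. by rewrite lerDl oppr_ge0 ln_le0. Qed.

Lemma decay_u_gt0 k : 0 < u k.
Proof. exact: lt_le_trans decay_b_gt0 (decay_u_ge k). Qed.

Lemma decay_kappa_gt0 : 0 < kappa.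
Proof. by rewrite divr_gt0 ?mulr_gt0 ?exprn_gt0. Qed.

Lemma decay_step k : phi k <= kappa * u k ^+ 2 * (phi k - phi k.+1).
Proof.
(* [x] solves [expR (c * x) * phi k = 4] and [r] is the next integer above it; the choice of [b]
   gives [u k / c = x + 2 >= r + 1]. *)
set x := (ln 4 - ln (phi k)) / c; pose r := (Num.truncn x).+1.
have x_ge0 : 0 <= x.
  rewrite divr_ge0 ?(ltW c_gt0)// addr_ge0 ?oppr_ge0 ?ln_le0// ln_ge0//.
  by rewrite ler1n.
have xr : x < r%:R by have := truncnS_gt x; rewrite /r.
have rx : r.+1%:R <= u k / c.
  have -> : u k / c = x + 2 by rewrite /x; field; rewrite gt_eqF.
  by rewrite /r -addn2 natrD lerD2r; have := truncn_le x; rewrite x_ge0.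
have e_ge : 4 <= expR (c * r%:R) * phi k.
  rewrite -ler_pdivrMr// -[leLHS]lnK ?posrE ?divr_gt0// ler_expR.
  rewrite ln_div ?posrE//.
  by rewrite mulrC -ler_pdivrMr// ltW.
have := phi_nash k r; set D := phi k - phi k.+1; set q := _ * (C * D) => H.
have D_ge0 : 0 <= D by rewrite subr_ge0.
(* Otherwise [phi k - q] exceeds half of [phi k], and the left side of [phi_nash] exceeds 2. *)
have phi_le : phi k <= 2 * q.
  have e_gt0 : 0 < expR (c * r%:R) by exact: expR_gt0.
  rewrite leNgt; apply/negP => Hq; move: H; apply/negP; rewrite -ltNge.
  have : expR (c * r%:R) * (2 * q) < expR (c * r%:R) * phi k.
    by rewrite ltr_pM2l.
  lra.
apply: le_trans phi_le _; rewrite /q.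
have -> : kappa * u k ^+ 2 * D = 2 * ((u k / c) ^+ 2 * (C * D)).
  by field; rewrite gt_eqF.
rewrite ler_wpM2l// ler_wpM2r ?mulr_ge0 ?(ltW C_gt0)//.
by rewrite ler_pXn2r ?nnegrE// divr_ge0 ?ltW ?decay_u_gt0.
Qed.

(** By [ln z <= z - 1] and [decay_step], [u] grows by at least [x = 1 / (kappa * u k ^ 2)] in one
    step, and [(u + x) ^ 3 >= u ^ 3 + 3 * u ^ 2 * x]. *)
Lemma decay_u_cube k : 3 / kappa * k%:R <= u k ^+ 3.
Proof.
elim: k => [|k IHk]; first by rewrite mulr0 exprn_ge0 ?ltW ?decay_u_gt0.
rewrite -[k.+1%:R]natr1 mulrDr mulr1.
have uk := decay_u_gt0 k; have kp := decay_kappa_gt0.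
set x := (kappa * u k ^+ 2)^-1.
have y_gt0 : 0 < kappa * u k ^+ 2 by rewrite mulr_gt0// exprn_gt0.
have x_gt0 : 0 < x by rewrite invr_gt0.
have u_inc : u k + x <= u k.+1.
  have H : x <= 1 - phi k.+1 / phi k.
    have -> : 1 - phi k.+1 / phi k = (phi k - phi k.+1) / phi k.
      by rewrite mulrBl divff// gt_eqF.
    rewrite ler_pdivlMr// mulrC ler_pdivrMr// mulrC.
    exact: decay_step.
  have L : ln (phi k.+1 / phi k) <= phi k.+1 / phi k - 1.
    rewrite -{1}[phi k.+1 / phi k](subrK 1) addrC le_ln1Dx//.
    by rewrite ltrBrDl addrN divr_gt0.
  by move: L; rewrite ln_div ?posrE//; lra.
apply: (@le_trans _ _ ((u k + x) ^+ 3)); last first.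
  by rewrite ler_pXn2r ?nnegrE ?(addr_ge0 (ltW uk) (ltW x_gt0))//
    ?(ltW (decay_u_gt0 _)).
have kE : 3 / kappa = 3 * u k ^+ 2 * x.
  by rewrite /x; field; rewrite !gt_eqF//= ?C_gt0 ?c_gt0.
apply: (@le_trans _ _ (u k ^+ 3 + 3 / kappa)); first by rewrite lerD2r.
rewrite kE -subr_ge0.
have -> : (u k + x) ^+ 3 - (u k ^+ 3 + 3 * u k ^+ 2 * x) =
  3 * u k * x ^+ 2 + x ^+ 3 by ring.
by rewrite addr_ge0 ?mulr_ge0 ?exprn_ge0 ?(ltW x_gt0) ?(ltW uk).
Qed.

Lemma decay_sqrt k : Num.sqrt (phi k) = expR ((b - u k) / 2).
Proof.
rewrite opprB addrC subrK -[RHS]ger0_norm ?expR_ge0// -sqrtr_sqr.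
by rewrite -expRM_natl mulrC divfK// lnK ?posrE.
Qed.

(** The quadratic Taylor bound [y ^ 2 / 2 <= expR y] at [y = x / 2]. *)
Lemma sqr_expRN_half (x : R) : 0 <= x -> x ^+ 2 * expR (- (x / 2)) <= 8.
Proof.
move=> x_ge0; rewrite expRN ler_pdivrMr ?expR_gt0//.
have := @expR_ge1Dxn R (x / 2) 1 (divr_ge0 x_ge0 (ler0n _ _)).
by rewrite (_ : 2`! = 2)%N// expr2 => H; rewrite expr2; lra.
Qed.

(** With [v] and [w] the two square roots, [v ^ 2 - w ^ 2 <= 2 * v * (v - w)] in [decay_step], and
    [u k ^ 2 * v] is bounded because [v] is exponentially small in [u k / 2]. *)
Lemma decay_telescope k :
  phi k <= M * (Num.sqrt (phi k) - Num.sqrt (phi k.+1)).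
Proof.
have v_gt0 j : 0 < Num.sqrt (phi j) by rewrite sqrtr_gt0.
have phiE j : phi j = Num.sqrt (phi j) ^+ 2 by rewrite sqr_sqrtr// ltW.
have v_dec : Num.sqrt (phi k.+1) <= Num.sqrt (phi k) by rewrite ler_wsqrtr.
have uv : u k ^+ 2 * Num.sqrt (phi k) <= 8 * expR (b / 2).
  rewrite decay_sqrt mulrBl expRD mulrCA [leRHS]mulrC ler_pM2l ?expR_gt0//.
  by rewrite sqr_expRN_half// ltW ?decay_u_gt0.
apply: le_trans (decay_step k) _.
rewrite [X in _ * (_ - X)](phiE k.+1) [X in _ * (X - _)](phiE k).
move: v_dec uv (v_gt0 k) (v_gt0 k.+1).
move: (Num.sqrt (phi k)) (Num.sqrt (phi k.+1)) => v w wv uv v0 w0.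
have kp := decay_kappa_gt0.
apply: (@le_trans _ _ (kappa * u k ^+ 2 * (2 * v * (v - w)))).
  rewrite ler_wpM2l//; first by rewrite mulr_ge0 ?exprn_ge0// ltW ?decay_u_gt0.
  by rewrite -subr_ge0 (_ : _ - _ = (v - w) ^+ 2) ?sqr_ge0//; ring.
have -> : kappa * u k ^+ 2 * (2 * v * (v - w)) =
  2 * kappa * (v - w) * (u k ^+ 2 * v) by ring.
have -> : M * (v - w) = 2 * kappa * (v - w) * (8 * expR (b / 2)) by ring.
apply: ler_wpM2l uv; apply: mulr_ge0; last by rewrite subr_ge0.
by apply: mulr_ge0 => //; exact: ltW.
Qed.

Lemma decay_M_gt0 : 0 < M.
Proof. by rewrite mulr_gt0 ?expR_gt0// mulr_gt0 ?decay_kappa_gt0. Qed.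

Lemma decay_sum N n : \sum_(N <= k < n) phi k <= M * Num.sqrt (phi N).
Proof.
have [nN|Nn] := leqP n N.
  by rewrite big_geq// mulr_ge0 ?sqrtr_ge0// ltW ?decay_M_gt0.
apply: (@le_trans _ _ (M * (Num.sqrt (phi N) - Num.sqrt (phi n)))).
  rewrite -opprB -(telescope_sumr (fun k => Num.sqrt (phi k)) (ltnW Nn)).
  rewrite -sumrN mulr_sumr; apply: ler_sum => k _.
  by rewrite opprB decay_telescope.
by rewrite ler_wpM2l ?(ltW decay_M_gt0)// gerBl sqrtr_ge0.
Qed.

Lemma decay_tail (K : R) : 0 <= K -> exists2 A : nat, (0 < A)%N &
  forall n N : nat, (0 < n)%N ->
    \sum_(A * n ^ 3 <= k < N) phi k <= 4^-1 * expR (- (K * n%:R)).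
Proof.
move=> K_ge0; have Mp := decay_M_gt0; have kp := decay_kappa_gt0.
(* [E] absorbs the prefactor, since [E * expR (- (E * n)) <= 1]; the factor 2 in [L] compensates the
   square root of [phi]. *)
pose E := 4 * M * expR (b / 2); pose L := 2 * (K + E).
have E_gt0 : 0 < E.
  by apply: mulr_gt0; [apply: mulr_gt0|exact: expR_gt0].
have L_gt0 : 0 < L by rewrite mulr_gt0// ltr_wpDl.
(* Large enough for [decay_u_cube] to give [u >= L * n] at time [A * n ^ 3]. *)
pose A := (Num.truncn ((3 / kappa)^-1 * L ^+ 3)).+1.
exists A => // n N n_gt0.
have AL : L ^+ 3 <= 3 / kappa * A%:R.
  have k3_gt0 : 0 < 3 / kappa by exact: divr_gt0.
  by rewrite -ler_pdivrMl// ltW// truncnS_gt.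
have n_ge1 : 1 <= n%:R :> R by rewrite ler1n.
have u_big : L * n%:R <= u (A * n ^ 3).
  have Ln_ge0 : 0 <= L * n%:R by apply: mulr_ge0 => //; exact: ltW.
  rewrite -(@ler_pXn2r _ 3) ?nnegrE ?Ln_ge0 ?(ltW (decay_u_gt0 _))//.
  apply: le_trans (decay_u_cube _); rewrite exprMn natrM natrX mulrA.
  by rewrite ler_wpM2r// exprn_ge0.
apply: le_trans (decay_sum _ _) _; rewrite decay_sqrt.
apply: (@le_trans _ _ (M * expR ((b - L * n%:R) / 2))).
  by rewrite ler_pM2l// ler_expR ler_pM2r// lerD2l lerN2.
have -> : (b - L * n%:R) / 2 = b / 2 + (- (K * n%:R) + - (E * n%:R)).
  by rewrite /L; field.
rewrite !expRD -[leRHS]mulr1.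
have -> : M * (expR (b / 2) * (expR (- (K * n%:R)) * expR (- (E * n%:R)))) =
  4^-1 * expR (- (K * n%:R)) * (E * expR (- (E * n%:R))) 
  by rewrite /E; field; rewrite gt_eqF.
rewrite ler_pM2l ?mulr_gt0 ?expR_gt0 ?invr_gt0//.
rewrite expRN ler_pdivrMr ?expR_gt0// mul1r.
apply: (@le_trans _ _ (1 + E)); first by rewrite lerDr.
apply: le_trans (expR_ge1Dx _) _.
by rewrite ler_expR -[leLHS]mulr1 ler_pM2l.
Qed.

(** The first term of the tail bound for [K = 1], with [expR (- n) <= 1 / n <= e]. *)
Lemma decay_to0 (e : R) : 0 < e -> exists k, phi k <= e.
Proof.
move=> e_gt0; have [A _ H] := decay_tail ler01.
pose n := (Num.truncn e^-1).+1; exists (A * n ^ 3)%N.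
have := H n (A * n ^ 3).+1 (ltn0Sn _); rewrite big_nat1 => /le_trans; apply.
have en : e^-1 < n%:R by exact: truncnS_gt.
have := @expR_ge1Dx R n%:R; rewrite mul1r expRN => En.
apply: (@le_trans _ _ n%:R^-1); last by rewrite invf_ple ?posrE ?invr_gt0// ltW.
apply: (@le_trans _ _ (expR n%:R)^-1).
  by rewrite ler_piMl ?invr_ge0 ?expR_ge0// invf_le1 ?ler1n.
by rewrite lef_pV2 ?posrE ?expR_gt0// (le_trans _ En)// lerDr.
Qed.
End Decay.

(** * Cardinality bounds through finite subsets *)

Section Counting.
Context {R : realType} {K : choiceType}.
Implicit Types (A : set K) (M : R).

Lemma le_counting A M : (M%:E <= counting A)%E ->
  exists2 Y : {fset K}, [set` Y] `<=` A & M <= #|`Y|%:R.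
Proof.
rewrite /counting; case: ifPn => [/asboolP finA|/asboolP infA].
  by rewrite lee_fin => MA; exists (fset_set A) => //; rewrite fset_setK.
move=> _; have [Y YA Yn] := infinite_set_fset (Num.truncn M).+1 infA.
exists Y => //; apply: le_trans (ltW (truncnS_gt M)) _.
by rewrite ler_nat.
Qed.

(** Finiteness of [A] is a consequence: an infinite set has a finite subset with more than [M]
    elements. *)
Lemma counting_le A M :
  (forall Y : {fset K}, [set` Y] `<=` A -> #|`Y|%:R <= M) ->
  (counting A <= M%:E)%E.
Proof.
move=> AM; rewrite /counting; case: ifPn => [/asboolP finA|/asboolP infA].
  by rewrite lee_fin AM// fset_setK.
have [Y YA Yn] := infinite_set_fset (Num.truncn M).+1 infA.
have := AM Y YA; rewrite leNgt => /negP[].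
by apply: lt_le_trans (truncnS_gt M) _; rewrite ler_nat.
Qed.

End Counting.

(** * Words and countability of the group *)

Lemma word_length_word (G : groupType) (S : {fset G}) (x : G) : generating S ->
  exists2 w, is_word_of S x w & size w = word_length S x.
Proof.
move=> /(_ x)[w0 w0x].
have ex : exists n, `[< exists2 w, is_word_of S x w & size w = n >].
  by exists (size w0); apply/asboolP; exists w0.
rewrite /word_length; case: xgetP => [n -> [] //|/(_ (ex_minn ex))[]].
case: ex_minnP => n /asboolP[w wx wn] n_min; split; first by exists w.
by move=> v vx; apply: n_min; apply/asboolP; exists v.
Qed.

(** Words over [S] are countable and map onto [G]. This makes products of discrete variables
    measurable in [discrete_rvM]. *)
Lemma generating_countable (G : groupType) (S : {fset G}) : generating S ->
  countable [set: G].
Proof.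
move=> S_gen; pose f (w : seq S) := word_prod [seq val s | s <- w].
apply: (sub_countable _ (countableP [set: seq S])).
suff -> : [set: G] = f @` [set: seq S] by exact: card_image_le.
apply/seteqP; split => // x _; have [w [wS <-]] := S_gen x.
exists (pmap insub w) => //; rewrite /f; congr word_prod.
rewrite (pmap_filter (@insubK _ _ _)).
by apply/all_filterP/allP => y /wS yS; rewrite insubT.
Qed.

(** * The law of the walk *)

Section Walk.
Context {R : realType} {G : groupType} (S : {fset G}) (mu : G -> R).
Hypothesis S_gen : generating S.
Hypothesis mu_law : probability_law mu.
Hypothesis mu_supp : forall x : G, (mu x != 0) = (x \in S).
Context {d : measure_display} {T : measurableType d} (P : probability T R).
Variable X : nat -> T -> G.
Hypothesis X_iid : iid_of_law P mu X.
Local Notation p := (step_prob S mu).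

Lemma law_gt0 s : s \in S -> 0 < mu s.
Proof. by rewrite -mu_supp lt0r => ->; case: mu_law => ->. Qed.

Lemma law_sum : \sum_(s <- S) mu s = 1.
Proof.
case: mu_law => mu_ge0 mu1; apply: EFin_inj; rewrite -mu1 -sumEFin.
rewrite fsbig_seq ?fset_uniq// -esum_fset//; last first.
  by move=> i _; rewrite lee_fin.
rewrite esum_mkcond; apply: eq_esum => x _.
case: ifPn => // xS; congr EFin; apply/eqP; rewrite eq_sym.
by apply: contraNT xS; rewrite mu_supp inE.
Qed.

Lemma measure_split (Z : T -> G) (W : set T) (Y : seq G) :
  discrete_rv Z -> measurable W -> uniq Y ->
  P (W `&` Z @^-1` [set` Y]) = (\sum_(y <- Y) P (W `&` Z @^-1` [set y]))%E.
Proof.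
move=> mZ mW; elim: Y => [|y Y IHY] /= => [_|/andP[yY uY]].
  by rewrite set_nil preimage_set0 setI0 measure0 big_nil.
rewrite big_cons -IHY// -measureU; [|exact: measurableI|exact: measurableI|].
  rewrite -setIUr; congr (P (_ `&` _)); apply/seteqP.
  split => t /=; rewrite inE; first by move=> /predU1P.
  by move=> /predU1P.
apply/seteqP; split => // t [[_ /= ->] [_ /=]].
by rewrite (negPf yY).
Qed.

Lemma discrete_rvM (Y Z : T -> G) : discrete_rv Y -> discrete_rv Z ->
  discrete_rv (fun t => Y t * Z t)%g.
Proof.
move=> mY mZ A.
have -> : (fun t => Y t * Z t)%g @^-1` A =
    \bigcup_g (Y @^-1` [set g] `&` Z @^-1` [set h | A (g * h)%g]).
  by apply/seteqP; split => [t At|t [g _] [/= <-]]//; exists (Y t).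
apply: countable_bigcupT_measurable => [|g]; last exact: measurableI.
exact: generating_countable S_gen.
Qed.

Lemma walkS k t : walk X 1%g k.+1 t = (walk X 1%g k t * X k t)%g.
Proof. by rewrite /walk big_ord_recr /= !mul1g. Qed.

Lemma walk_rv k : discrete_rv (walk X 1%g k).
Proof.
elim: k => [|k IHk].
  move=> A; rewrite [walk _ _ _](_ : _ = cst 1%g).
    by rewrite preimage_cst; case: ifPn.
  by apply/funext => t; rewrite /walk big_ord0 mulg1.
have [mX _ _] := X_iid; have := discrete_rvM IHk (mX k).
by congr discrete_rv; apply/funext => t; rewrite walkS.
Qed.

Lemma increment_null k : P (~` (X k @^-1` [set` S])) = 0%E.
Proof.
have [mX X_law _] := X_iid; rewrite probability_setC; last exact: mX.
rewrite -[X in P X]setTI measure_split ?fset_uniq//.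
under eq_bigr do rewrite setTI X_law.
by rewrite sumEFin law_sum subee.
Qed.

Lemma increment_support k (W : set T) : measurable W ->
  P (W `&` X k @^-1` [set` S]) = P W.
Proof.
have [mX _ _] := X_iid => mW.
rewrite [RHS](measureDI P mW (mX k [set` S])) [X in (X + _)%E](_ : _ = 0%E).
  by rewrite add0e.
apply: (@subset_measure0 _ _ _ _ _ (~` (X k @^-1` [set` S]))) => //.
- by apply: measurableD => //; exact: mX.
- by apply: measurableC; exact: mX.
- exact: increment_null.
Qed.

(** Events about later increments are carried along to strengthen the induction: increment [k] joins
    [J], and mutual independence is invoked only at time 0. *)
Lemma walk_law_indep k z (J : {fset nat}) (A : nat -> set G) :
  (forall j, j \in J -> (k <= j)%N) ->
  P (walk X 1%g k @^-1` [set z] `&` \bigcap_(i in [set` J]) (X i @^-1` A i)) =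
  ((p k z)%:E * \prod_(i <- J) P (X i @^-1` A i))%E.
Proof.
have [mX X_law X_ind] := X_iid.
elim: k z J A => [|k IHk] z J A kJ.
  have -> : walk X 1%g 0 @^-1` [set z] = if z == 1%g then setT else set0.
    apply/seteqP; split => t /=; rewrite /walk big_ord0 mulg1.
      by move=> <-; rewrite eqxx.
    by case: eqP => // ->.
  rewrite /=; case: ifPn => _; last by rewrite set0I measure0 mul0e.
  by rewrite setTI mul1e X_ind.
set E := \bigcap_(i in _) _; set W := _ `&` E.
have mE : measurable E.
  by apply: fin_bigcap_measurable => // i _; exact: mX.
have mW : measurable W by apply: measurableI => //; exact: walk_rv.
rewrite -(increment_support k mW) measure_split ?fset_uniq//.
have k_notin : k \notin J by apply/negP => /kJ; rewrite ltnn.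
(* Extends the family of events by the value [s] of increment [k]. *)
pose A' s i := if i == k then [set s] else A i.
have JE s : (\prod_(i <- J) P (X i @^-1` A' s i) =
    \prod_(i <- J) P (X i @^-1` A i))%E.
  apply: eq_big_seq => i iJ; rewrite /A'; case: eqP iJ k_notin => // ->.
  by move=> ->.
have WE s : W `&` X k @^-1` [set s] = walk X 1%g k @^-1` [set (z * s^-1)%g] `&`
    \bigcap_(i in [set` (k |` J)%fset]) (X i @^-1` A' s i).
  rewrite bigcap_fsetU1 {1}/A' eqxx.
  have -> : \bigcap_(i in [set` J]) (X i @^-1` A' s i) = E.
    apply: eq_bigcapr => i /= iJ; rewrite /A'; case: eqP iJ k_notin => // ->.
    by move=> ->.
  rewrite /W; apply/seteqP; split => t /=; rewrite walkS.
    by move=> [[<- Et] <-]; split=> //; rewrite mulgK.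
  by move=> [-> [<- Et]]; rewrite mulgVK.
have [c cE] : exists c : R, (\prod_(i <- J) P (X i @^-1` A i) = c%:E)%E.
  exists (\prod_(i <- J) fine (P (X i @^-1` A i))); rewrite -prodEFin.
  by apply: eq_bigr => i _; rewrite fineK// fin_num_measure//; exact: mX.
rewrite cE /= -EFinM mulr_suml -sumEFin; apply: eq_bigr => s _.
rewrite WE IHk; last first.
  by move=> j; rewrite !inE => /predU1P[->//|/kJ]; exact: ltnW.
rewrite big_fsetU1//= JE cE {1}/A' eqxx X_law -!EFinM.
by congr EFin; rewrite mulrCA mulrA.
Qed.

Lemma walk_law k z : P (walk X 1%g k @^-1` [set z]) = (p k z)%:E.
Proof.
have := @walk_law_indep k z fset0 (fun=> setT).
rewrite big_seq_fset0 mule1 => <- //; congr (P _).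
by rewrite [X in _ `&` X](_ : _ = setT) ?setIT//; apply/seteqP.
Qed.

(** * Hitting and exit probabilities *)

Local Notation hits y := (\bigcup_k walk X 1%g k @^-1` [set y]).
Local Notation F y := (hitting_prob P X 1%g y).

Lemma hitting_probE y : (F y)%:E = P (hits y).
Proof.
rewrite /hitting_prob [X in P X](_ : _ = hits y).
  rewrite fineK// fin_num_measure//; apply: bigcup_measurable => k _.
  exact: walk_rv.
apply/seteqP; split => t /=; rewrite /hitting_time.
  set B := [set _ | _ in _] => B_fin.
  have [[_ [k ky _]]|B0] := pselect (B !=set0); first by exists k.
  move: B_fin; suff -> : B = set0 by rewrite ereal_inf0 ltxx.
  by apply/seteqP; split => // x Bx; apply: B0; exists x.
move=> [k _ ky]; apply: (@le_lt_trans _ _ (k%:R : R)%:E); last by rewrite ltry.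
by apply: ereal_inf_lbound; exists k.
Qed.

(** Union bound over the times of visit to [y]; partial sums keep the Green function inside [R]. *)
Lemma hitting_prob_le y c :
  (forall n, \sum_(0 <= k < n) p k y <= c) -> F y <= c.
Proof.
move=> yc; rewrite -lee_fin hitting_probE.
apply: le_trans (generalized_Boole_inequality _ _ _) _.
- by move=> k; exact: walk_rv.
- by apply: bigcup_measurable => k _; exact: walk_rv.
apply: lime_le; first by apply: is_cvg_nneseries => k _ _; exact: measure_ge0.
apply: nearW => n; rewrite (eq_bigr (fun k => (p k y)%:E)); last first.
  by move=> k _; exact: walk_law.
by rewrite sumEFin lee_fin.
Qed.

Lemma hitting_prob_ge k y : p k y <= F y.
Proof.
rewrite -lee_fin hitting_probE -walk_law le_measure ?inE//.
- exact: walk_rv.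
- by apply: bigcup_measurable => j _; exact: walk_rv.
- by move=> t yt; exists k.
Qed.

Lemma hitting_prob_gt0 y : 0 < F y.
Proof.
have [w [wS <-]] := S_gen y.
exact: lt_le_trans (step_prob_word_gt0 law_gt0 wS) (hitting_prob_ge _ _).
Qed.

(* Up to a null event the walk can leave B only through D. *)
Lemma exit_prob (B : {fset G}) (D : seq G) k : 1%g \in B ->
  (forall b s, b \in B -> s \in S -> (b * s)%g \notin B -> (b * s)%g \in D) ->
  1 - \sum_(b <- B) p k b <= \sum_(y <- D) F y.
Proof.
move=> B1 BD; have [mX _ _] := X_iid.
have mhits y : measurable (hits y).
  by apply: bigcup_measurable => j _; exact: walk_rv.
pose N := \bigcup_j ~` (X j @^-1` [set` S]).
have mNj j : measurable (~` (X j @^-1` [set` S])).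
  by apply: measurableC; exact: mX.
have mN : measurable N by exact: bigcup_measurable.
have PN : P N = 0%E.
  apply/eqP; rewrite eq_le measure_ge0 andbT.
  apply: le_trans (generalized_Boole_inequality _ _ _) _ => //.
  by rewrite eseries0// => j _ _; exact: increment_null.
pose H := \bigcup_(y in [set` D]) hits y.
have mH : measurable H by apply: fin_bigcup_measurable => //; exact: finite_seq.
(* Outside [B] at time [k + 1], the walk was already outside at time [k], or its last step left [B]:
   it then hits [D] unless that increment is outside [S]. *)
have sub : ~` (walk X 1%g k @^-1` [set` B]) `<=` H `|` N.
  move=> t; elim: k => [|k IHk] /=.
    by rewrite /walk big_ord0 mulg1 => /(_ B1).
  have [Bk|Bk _] := boolP (walk X 1%g k t \in B); last first.
    exact: (IHk (elimN idP Bk)).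
  rewrite walkS => /negP nB; have [XS|XS] := boolP (X k t \in S); last first.
    by right; exists k => //; exact/negP.
  left; exists (walk X 1%g k.+1 t); last by exists k.+1.
  by rewrite walkS /= BD.
have mB : measurable (walk X 1%g k @^-1` [set` B]) by exact: walk_rv.
rewrite -lee_fin EFinB -sumEFin.
under eq_bigr do rewrite -walk_law -[walk _ _ _ @^-1` _]setTI.
rewrite -measure_split ?fset_uniq//; last exact: walk_rv.
rewrite setTI -probability_setC// -sumEFin.
under eq_bigr do rewrite hitting_probE.
apply: (@le_trans _ _ (P (H `|` N))).
  by rewrite le_measure ?inE//; [exact: measurableC|exact: measurableU].
apply: (@le_trans _ _ (P H + P N)%E); first exact: measureU2.
rewrite PN adde0 /H bigcup_seq.
have [] // : measurable (\big[setU/set0]_(y <- D) hits y) /\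
  (P (\big[setU/set0]_(y <- D) hits y) <= \sum_(y <- D) P (hits y))%E.
apply: (big_ind2 (fun A c => measurable A /\ (P A <= c)%E)) => //.
- by rewrite measure0.
- move=> A c A' c' [mA Ac] [mA' Ac']; split; first exact: measurableU.
  by apply: le_trans (measureU2 _ mA mA') _; exact: leeD.
Qed.

(** Balls of the hitting distance are superlevel sets of [F]; positivity of [F y] excludes the
    default value of [ln]. *)
Lemma hitting_dist_le x y :
  (hitting_dist P X 1%g y <= x) = (expR (- x) <= F y).
Proof.
rewrite -[F y in RHS]lnK ?posrE ?hitting_prob_gt0// ler_expR.
by rewrite /hitting_dist lerNl.
Qed.

(** * Return probabilities under exponential growth *)

Hypothesis S_sym : symmetric_set S.
Hypothesis G_exp : exponential_growth R S.
Hypothesis mu_sym : forall x : G, mu (x^-1)%g = mu x.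
Local Notation phi k := (p k.*2 1%g).

Lemma law_lower_bound : exists2 m : R, 0 < m & forall s, s \in S -> m <= mu s.
Proof.
suff H (r : seq G) : (forall s, s \in r -> 0 < mu s) ->
    exists2 m : R, 0 < m & forall s, s \in r -> m <= mu s.
  by apply: (H S); exact: law_gt0.
elim: r => [|a r IHr] r_gt0; first by exists 1.
have [|m m_gt0 m_min] := IHr.
  by move=> s sr; apply: r_gt0; rewrite inE sr orbT.
exists (Num.min m (mu a)); first by rewrite lt_min m_gt0 r_gt0 ?mem_head.
by move=> s; rewrite inE ge_min => /predU1P[->|/m_min->//]; rewrite lexx orbT.
Qed.

(** [c] is the growth rate and [C] is [1 / m ^ 2], with [m] a lower bound of [mu] on [S];
    [ball_bound] is applied to a finite part of the word ball. *)
Lemma return_prob_nash : exists c C : R, [/\ 0 < c, 0 < C & forall k r : nat,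
  expR (c * r%:R) * (phi k - r.+1%:R ^+ 2 * (C * (phi k - phi k.+1))) <= 2].
Proof.
have [c c_gt0 growth] := G_exp; have [m m_gt0 m_min] := law_lower_bound.
exists c, (m ^+ 2)^-1; split=> // [|k r]; first by rewrite invr_gt0 exprn_gt0.
have [Y Yball Y_ge] := le_counting (growth r).
have := ball_bound S_sym law_gt0 mu_sym law_sum m_gt0 m_min k (fset_uniq Y).
move=> /(_ r) H; rewrite (mulrC (m ^+ 2)^-1).
(* The lower bound on the size of [Y] can be inserted only before a nonnegative factor; for a
   negative one the left side is at most 0. *)
have [q_ge0|q_lt0] :=
  leP 0 (phi k - r.+1%:R ^+ 2 * ((phi k - phi k.+1) / m ^+ 2)).
  apply: le_trans (ler_wpM2r q_ge0 Y_ge) (H _) => y /Yball /= y_le.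
  by have [w wy wl] := word_length_word y S_gen; exists w => //; rewrite wl.
by apply: (@le_trans _ _ 0) => //; rewrite mulr_ge0_le0 ?expR_ge0 ?ltW.
Qed.

Lemma return_prob_le1 k : phi k <= 1.
Proof.
have := step_prob_sum_le1 law_gt0 law_sum k.*2 (isT : uniq [:: 1%g]).
by rewrite big_seq1.
Qed.

Lemma return_prob_dec k : phi k.+1 <= phi k.
Proof. by rewrite -subr_ge0 gap_ge0//; [exact: law_gt0|exact: law_sum]. Qed.

Lemma return_prob_to0 (e : R) : 0 < e -> exists k, phi k <= e.
Proof.
have [c [C [c_gt0 C_gt0 nash]]] := return_prob_nash.
apply: (decay_to0 c_gt0 C_gt0 _ return_prob_le1 return_prob_dec nash) => k.
exact: (step_prob_return_gt0 S_sym law_gt0 law_sum).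
Qed.

Lemma return_prob_tail (K : R) : 0 <= K -> exists2 A : nat, (0 < A)%N &
  forall n N : nat, (0 < n)%N ->
    \sum_(A * n ^ 3 <= k < N) phi k <= 4^-1 * expR (- (K * n%:R)).
Proof.
have [c [C [c_gt0 C_gt0 nash]]] := return_prob_nash.
apply: (decay_tail c_gt0 C_gt0 _ return_prob_le1 return_prob_dec nash) => k.
exact: (step_prob_return_gt0 S_sym law_gt0 law_sum).
Qed.

(** Times are paired as [2k], [2k + 1]; from [k = N] on, both terms of a pair are at most [phi k],
    whence [2 * e]. *)
Lemma hitting_prob_split (N : nat) (e : R) y :
  (forall n, \sum_(N <= k < n) phi k <= e) ->
  F y <= \sum_(0 <= k < N) (p k.*2 y + p k.*2.+1 y) + 2 * e.
Proof.
move=> tail; apply: hitting_prob_le => n.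
have double_sum (f : nat -> R) j :
    \sum_(0 <= k < j.*2) f k = \sum_(0 <= k < j) (f k.*2 + f k.*2.+1).
  by elim: j => [|j IHj]; rewrite ?big_nil// doubleS !big_nat_recr//= IHj addrA.
apply: (@le_trans _ _ (\sum_(0 <= k < (N + n).*2) p k y)).
  have nN : (n <= (N + n).*2)%N by rewrite -addnn addnA leq_addl.
  rewrite [leRHS](big_cat_nat (n := n))//= lerDl sumr_ge0// => k _.
  exact: (step_prob_ge0 law_gt0).
rewrite double_sum (big_cat_nat (n := N)) ?leq_addr//= lerD2l.
apply: le_trans (ler_wpM2l (ler0n _ 2) (tail (N + n)%N)).
rewrite mulr_sumr; apply: ler_sum => k _; rewrite mulr_natl mulr2n.
apply: lerD; first exact: step_prob_max.
exact: (step_prob_odd S_sym law_gt0 mu_sym law_sum).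
Qed.

(** * The two bounds on the growth of hitting balls *)

Local Notation K := (hitting_step P X S).

Lemma hitting_step_ge0 : 0 <= K.
Proof. exact: bigmax_ge_id. Qed.

Lemma hitting_growth_le : exists2 Cb : R, 0 < Cb & forall n : nat, (0 < n)%N ->
  (hitting_growth P X S n <= (Cb * n%:R ^+ 3 * expR (K * n%:R))%:E)%E.
Proof.
have [A A_gt0 tail] := return_prob_tail hitting_step_ge0.
(* Comes from [#|Y| * e <= 2 * A * n ^ 3 + #|Y| * e / 2], which is [sumY] below. *)
exists (4 * A%:R) => [|n n_gt0]; first by rewrite mulr_gt0// ltr0n.
apply: counting_le => Y YV; set e := expR (- (K * n%:R)).
have F_ge y : y \in Y -> e <= F y by move=> /YV; rewrite /= hitting_dist_le.
have F_le y : F y <=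
    \sum_(0 <= k < A * n ^ 3) (p k.*2 y + p k.*2.+1 y) + 2 * (4^-1 * e).
  by apply: hitting_prob_split => N; exact: tail.
have sumY : #|` Y|%:R * e <= 2 * (A * n ^ 3)%:R + #|` Y|%:R * (2 * (4^-1 * e)).
  rewrite -!sumr_const_seq; apply: (@le_trans _ _ (\sum_(y <- Y) F y)).
    by rewrite big_seq [leRHS]big_seq; apply: ler_sum => y; exact: F_ge.
  apply: le_trans (ler_sum _ (fun y _ => F_le y)) _.
  rewrite big_split lerD2r exchange_big.
  apply: (@le_trans _ _ (\sum_(0 <= k < A * n ^ 3) 2)).
    apply: ler_sum => k _; rewrite big_split (_ : 2 = 1 + 1)//.
    by apply: lerD; exact: (step_prob_sum_le1 law_gt0 law_sum _ (fset_uniq Y)).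
  by rewrite sumr_const_nat subn0 mulr_natr.
have e_gt0 : 0 < e by exact: expR_gt0.
have -> : expR (K * n%:R) = e^-1 by rewrite /e expRN invrK.
rewrite ler_pdivlMr//; move: sumY; rewrite natrM natrX; lra.
Qed.

Lemma hitting_growth_ge : exists2 Ca : R, 0 < Ca & forall n : nat,
  ((Ca * expR (K * n%:R))%:E <= hitting_growth P X S n)%E.
Proof.
have S_gt0 : 0 < #|` S|%:R :> R.
  have [s sS] := support_nonempty law_sum.
  by rewrite ltr0n cardfs_gt0; apply/fset0Pn; exists s.
(* The walk leaves [B] with probability at least 1/2, which yields [1 / 2 <= #|B| * #|S| * e]. *)
exists (2 * #|` S|%:R)^-1 => [|n]; first by rewrite invr_gt0 mulr_gt0.
(* For an infinite ball the count is [+oo] and the bound is immediate. *)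
rewrite /hitting_growth /counting; case: ifPn => [/asboolP finV|_]; last first.
  exact: leey.
set B := fset_set _; rewrite lee_fin.
have BE y : (y \in B) = (expR (- (K * n%:R)) <= F y).
  rewrite /B in_fset_set// -hitting_dist_le.
  by apply/idP/idP; rewrite inE.
set e := expR (- (K * n%:R)) in BE.
have e_gt0 : 0 < e by exact: expR_gt0.
have B1 : 1%g \in B.
  rewrite BE; apply: (@le_trans _ _ 1); last first.
    by apply: le_trans (hitting_prob_ge 0 _); rewrite /= eqxx.
  by rewrite expR_le1 oppr_le0 mulr_ge0// hitting_step_ge0.
have B_gt0 : 0 < #|` B|%:R :> R.
  by rewrite ltr0n cardfs_gt0; apply/fset0Pn; exists 1%g.
pose D := [seq y <- [seq (b * s)%g | b <- B, s <- S] | y \notin B].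
(* At time [2k] each point of [B] has mass at most [1 / (2 * #|B|)], so [B] carries at most half of
   the total. *)
have [|k phik] := @return_prob_to0 (2 * #|` B|%:R)^-1.
  by rewrite invr_gt0 mulr_gt0.
have sumB : \sum_(b <- B) p k.*2 b <= 2^-1.
  apply: (@le_trans _ _ (\sum_(b <- B) (2 * #|` B|%:R)^-1)).
    apply: ler_sum => b _; apply: le_trans phik.
    exact: (step_prob_max S_sym mu_sym).
  by rewrite sumr_const_seq invfM mulrCA mulfV ?mulr1 ?gt_eqF.
have sumD : \sum_(y <- D) F y <= #|` B|%:R * #|` S|%:R * e.
  apply: (@le_trans _ _ (\sum_(y <- D) e)).
    rewrite big_seq [leRHS]big_seq; apply: ler_sum => y.
    by rewrite mem_filter BE -ltNge => /andP[/ltW].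
  rewrite sumr_const_seq ler_wpM2r ?(ltW e_gt0)// -natrM ler_nat size_filter.
  by rewrite -(size_allpairs (fun b s => (b * s)%g)) count_size.
have exit : 1 - \sum_(b <- B) p k.*2 b <= \sum_(y <- D) F y.
  apply: exit_prob => // b s bB sS bsB; rewrite mem_filter bsB.
  by apply/allpairsP; exists (b, s).
have -> : expR (K * n%:R) = e^-1 by rewrite /e expRN invrK.
rewrite ler_pdivrMl ?mulr_gt0// -[leLHS]mul1r ler_pdivrMr//.
move: exit sumB sumD; lra.
Qed.
End Walk.

Theorem proposition2p3 (R : realType) (G : groupType) (S : {fset G})
    (S_sym : symmetric_set S) (S_gen : generating S)
    (G_exp : exponential_growth R S)
    (mu : G -> R) (mu_law : probability_law mu)
    (mu_supp : forall x : G, (mu x != 0) = (x \in S))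
    (mu_sym : forall x : G, mu (x^-1)%g = mu x)
    (d : measure_display) (T : measurableType d) (P : probability T R)
    (X : nat -> T -> G) (X_iid : iid_of_law P mu X) :
  exists Ca Cb : R, [/\ 0 < Ca, 0 < Cb &
    forall n : nat, (1 <= n)%N ->
      ((Ca * expR (hitting_step P X S * n%:R))%:E <= hitting_growth P X S n)%E /\
      (hitting_growth P X S n
         <= (Cb * n%:R ^+ 3 * expR (hitting_step P X S * n%:R))%:E)%E].
Proof.
have [Ca Ca_gt0 lower] := hitting_growth_ge S_gen mu_law mu_supp X_iid S_sym
  G_exp mu_sym.
have [Cb Cb_gt0 upper] := hitting_growth_le S_gen mu_law mu_supp X_iid S_sym
  G_exp mu_sym.
by exists Ca, Cb; split=> // n n_gt0; split; [exact: lower|exact: upper].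
Qed.
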